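(* Let $p$ be an odd prime. Every powerful $p$-group of order at most $p^5$ is powerfully solvable.
   Context: $G^{p}$ denotes the subgroup generated by all $p$-th powers of elements of $G$. A finite $p$-group $G$ is powerful if $[G,G]\le G^p$. A chain of subgroups $H_0\ge H_1\ge\cdots\ge H_n$ of $G$ is powerfully abelian if $[H_i,H_i]\le H_{i+1}^p$ for $i=0,\ldots,n-1$. A finite $p$-group $G$ is powerfully solvable if there is a powerfully abelian chain $G=G_0\ge G_1\ge\cdots\ge G_n=1$. *)

(* Defs.v *)
From HB Require Import structures.
From mathcomp Require Import all_boot all_fingroup all_solvable.

Set Implicit Arguments.
Unset Strict Implicit.
Unset Printing Implicit Defensive.

Local Open Scope group_scope.

Section PowerfullySolvable.

Variables (gT : finGroupType) (p : nat).
Implicit Types (A : {set gT}) (G H K : {group gT}) (s : seq {group gT}).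

(* G^p; for a p-group this is 'Mho^1(G), but it is defined here for the given *)
(* p, independently of the orders of the elements.                            *)
Definition power_subgroup A : {set gT} := <<[set x ^+ p | x in A]>>.

Canonical power_subgroup_group A : {group gT} :=
  Eval hnf in [group of power_subgroup A].

Definition powerful G : bool :=
  p.-group G && ([~: G, G] \subset power_subgroup G).

(* The chain H_0 >= H_1 >= ... >= H_n is given by its head H = H_0 and the    *)
(* sequence s = [:: H_1; ...; H_n].                                           *)
Definition powerfully_abelian_chain H s : bool :=
  path (fun H1 H2 : {group gT} =>
          (H2 \subset H1) && ([~: H1, H1] \subset power_subgroup H2)) H s.

Definition powerfully_solvable G : Prop :=
  p.-group G /\
  exists s : seq {group gT},
    powerfully_abelian_chain G s /\ last G s = 1%G.

End PowerfullySolvable.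

(* Main.v *)
Require Import Defs.
From mathcomp Require Import all_boot all_fingroup all_solvable.

Set Implicit Arguments.
Unset Strict Implicit.
Unset Printing Implicit Defensive.

Local Open Scope group_scope.

(* Write M = G^p.  In a powerful G with p odd, [M, G] <= [G, G]^p, and hence   *)
(* every element of M is a p-th power.  If moreover G = <x, y>, the inclusion *)
(* makes [G, G] cyclic, generated by [x, y] = c^p, and G >= <c> >= 1 is a     *)
(* powerfully abelian chain.  If instead M = <s, t> with s = x^p and t = y^p, *)
(* then H = <x, y> is powerful because [G, G] <= M <= H^p, so the chain of H  *)
(* can be prefixed with G.  Since M is the Frattini subgroup, order at most   *)
(* p^5 leaves |G / M| <= p^2 or |M| <= p^2, so one of these two cases occurs. *)

(** If [G] and M both needed three generators, then G/M and M would each have order at least p^3,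
    forcing |G| >= p^6. So [powerfully_solvable_2gen] or [powerfully_solvable_2gen_Mho1] applies.
    Both build the next member of the chain from p-th roots of elements of M, which
    [Mho1_powerful_expg] supplies. Behind it is [comm_Mho1_powerful], obtained by expanding a p-th
    power, where odd p divides the binomial coefficient binom(p,2). *)

Lemma der1_exponent_comm_Mho1 (gT : finGroupType) (p : nat) (G : {group gT}) :
    p.-group G -> odd p -> G^`(1) \subset 'Mho^1(G) -> 'Mho^1(G^`(1)) = 1 ->
    [~: 'Mho^1(G), G, G] = 1 ->
  [~: 'Mho^1(G), G] = 1.
Proof.
move=> pG p_odd sDM MD1 cMGG; apply/commG1P; rewrite (MhoE 1 pG) gen_subG.
have cMG x y : x \in 'Mho^1(G) -> y \in G -> [~ x, y] \in 'C(G).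
  by move=> Mx Gy; move/commG1P/subsetP: cMGG; apply; rewrite mem_commg.
have Dp c : c \in G^`(1) -> c ^+ p = 1.
  move=> Dc; apply/eqP; rewrite -in_set1 -[[set _]]/[1 gT] -MD1 -[p]expn1.
  by apply: Mho_p_elt => //; apply: mem_p_elt (pgroupS (der_sub 1 G) pG) Dc.
apply/subsetP=> _ /imsetP[x Gx ->]; apply/centP=> y Gy; rewrite expn1.
set c := [~ x, y]; have Dc : c \in G^`(1) by apply: mem_commg.
have Gc : c \in G := subsetP (der_sub 1 G) c Dc.
have cc := cMG c x (subsetP sDM c Dc) Gx.
(* The conjugate of x^p by y is (x c)^p = x^p c^p [c, x]^binom(p,2), since [c, x] is central. Both c
   and [c, x] lie in G', where p-th powers vanish, and p divides binom(p,2). *)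
apply/commgP/conjg_fixP; rewrite conjXg conjg_mulR -/c.
rewrite expMg_Rmul; [ | exact/commute_sym/(centP cc) ..].
by rewrite (Dp c Dc) mulg1 bin2odd // expgM (Dp [~ c, x]) ?expg1n ?mulg1 ?mem_commg.
Qed.

(* By nilpotence it suffices to bound M = [G^p, G] by N [M, G], where         *)
(* N = [G, G]^p; modulo N [M, G] the previous lemma applies.                  *)
Lemma comm_Mho1_powerful (gT : finGroupType) (p : nat) (G : {group gT}) :
    p.-group G -> odd p -> G^`(1) \subset 'Mho^1(G) ->
  [~: 'Mho^1(G), G] \subset 'Mho^1(G^`(1)).
Proof.
move=> pG p_odd sDM; set M := [~: _, G]; set N := 'Mho^1(_).
have nMG : M <| G by rewrite /normal commg_normr comm_subG ?Mho_sub.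
have nNG : N <| G by rewrite !gFnormal_trans.
have nMGG : [~: M, G] <| G.
  by rewrite /normal commg_normr comm_subG ?normal_sub.
pose K := N <*> [~: M, G].
have nKG : K <| G by apply: normalY.
have sMK : M \subset K.
  rewrite -quotient_sub1 ?(subset_trans (normal_sub nMG)) ?normal_norm //.
  have KM : 'Mho^1(G) / K = 'Mho^1(G / K).
    by rewrite /quotient morphim_Mho ?normal_norm.
  have KD : G^`(1) / K = (G / K)^`(1) by rewrite quotient_der ?normal_norm.
  have nK := normal_norm nKG.
  have nKM : 'Mho^1(G) \subset 'N(K) by apply: subset_trans (Mho_sub _ _) nK.
  rewrite quotientR // KM.
  rewrite (@der1_exponent_comm_Mho1 _ p) ?quotient_pgroup //.
  - by rewrite -KM -KD quotientS.
  - rewrite -KD /quotient -morphim_Mho ?(subset_trans (der_sub 1 G)) //.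
    by apply: quotientS1; apply: joing_subl.
  rewrite -KM -!quotientR //; first by apply: quotientS1; apply: joing_subr.
  by apply: subset_trans nK; apply: normal_sub.
have nNG' := normal_norm nNG; have sMG := normal_sub nMG.
have nNM := subset_trans sMG nNG'.
rewrite -quotient_sub1 //.
have nilGN : nilpotent (G / N) := quotient_nil N (pgroup_nil pG).
(* [nilpotent] unfolds to: a subgroup contained in its own commutator with the group is trivial. *)
have := implyP (forallP nilGN (M / N)%G); rewrite subsetI quotientS //= => nil.
suff /nil/eqP-> : M / N \subset [~: M / N, G / N] by [].
rewrite -quotientR //; apply: subset_trans (quotientS _ sMK) _.
by rewrite /K /= quotientYidl // (subset_trans (normal_sub nMGG)).
Qed.

Lemma comm_Mho1_sub_Mho2 (gT : finGroupType) (p : nat) (G : {group gT}) :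
    p.-group G -> odd p -> G^`(1) \subset 'Mho^1(G) ->
  [~: 'Mho^1(G), G] \subset 'Mho^1('Mho^1(G)).
Proof.
move=> pG p_odd sDM; apply: subset_trans (comm_Mho1_powerful pG p_odd sDM) _.
exact: MhoS.
Qed.

(** Here (x y)^p = x^p y^p [y, x]^binom(p,2), and the last factor is 1 because [y, x] lies in G^p,
    which is central with trivial p-th powers. So the set of p-th powers is already a group. *)
Lemma Mho1_central_expg (gT : finGroupType) (p : nat) (G : {group gT}) g :
    p.-group G -> odd p -> G^`(1) \subset 'Mho^1(G) -> G \subset 'C('Mho^1(G)) ->
    'Mho^1('Mho^1(G)) = 1 -> g \in 'Mho^1(G) ->
  exists2 x, x \in G & g = x ^+ p.
Proof.
move=> pG p_odd sDM cMG MM1.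
have cGM a b : a \in 'Mho^1(G) -> b \in G -> commute a b.
  by move=> Ma Gb; apply/commute_sym/(centP (subsetP cMG b Gb)).
have Mp c : c \in 'Mho^1(G) -> c ^+ p = 1.
  move=> Mc; apply/eqP; rewrite -in_set1 -[[set _]]/[1 gT] -MM1 -[p in c ^+ p]expn1.
  by apply: Mho_p_elt => //; apply: mem_p_elt (pgroupS (Mho_sub 1 G) pG) Mc.
have gP : group_set [set x ^+ p | x in G].
  apply/group_setP; split; first by apply/imsetP; exists 1; rewrite ?expg1n.
  move=> _ _ /imsetP[x Gx ->] /imsetP[y Gy ->]; apply/imsetP.
  exists (x * y); rewrite ?groupM //.
  have Mc : [~ y, x] \in 'Mho^1(G) by apply: subsetP sDM _ _; apply: mem_commg.
  rewrite expMg_Rmul; try exact/commute_sym/cGM.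
  by rewrite bin2odd // expgM (Mp _ Mc) expg1n mulg1.
rewrite (MhoE 1 pG) expn1 -[[set _ | _ in _]]/(gval (Group gP)) genGid.
by case/imsetP=> x; exists x.
Qed.

(** Modulo (G^p)^p, the subgroup G^p becomes central by [comm_Mho1_sub_Mho2], so the central case
    applies to the quotient. *)
Lemma Mho1_powerful_expg_coset (gT : finGroupType) (p : nat) (G : {group gT}) g :
    p.-group G -> odd p -> G^`(1) \subset 'Mho^1(G) -> g \in 'Mho^1(G) ->
  exists2 x, x \in G & x ^- p * g \in 'Mho^1('Mho^1(G)).
Proof.
move=> pG p_odd sDM Mg; set K := 'Mho^1('Mho^1(G)).
have nKG : G \subset 'N(K) by rewrite normal_norm ?gFnormal_trans.
have Gg := subsetP (Mho_sub 1 G) g Mg.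
have MK : 'Mho^1(G) / K = 'Mho^1(G / K) by rewrite /quotient morphim_Mho.
have nKM : 'Mho^1(G) \subset 'N(K) by apply: subset_trans (Mho_sub _ _) nKG.
have [||||||xK] := @Mho1_central_expg _ p (G / K)%G (coset K g).
- exact: quotient_pgroup.
- by [].
- by rewrite -MK -quotient_der ?quotientS.
- rewrite -MK centsC; apply: quotient_cents2r.
  exact: comm_Mho1_sub_Mho2 pG p_odd sDM.
- by rewrite -MK /quotient -morphim_Mho //; apply: trivg_quotient.
- by rewrite -MK mem_quotient.
case/morphimP=> x Nx Gx -> eq_g; exists x => //.
have Ng := subsetP nKG g Gg.
apply: coset_idr; first by rewrite groupM ?groupV ?groupX.
rewrite morphM ?groupV ?groupX // morphV ?groupX // morphX //=.
by rewrite eq_g mulVg.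
Qed.

(* If g = x^p modulo (G^p)^p, then g is already in H^p for H = <x, G^p>, so    *)
(* the induction descends to H unless G is cyclic.                            *)
Lemma Mho1_powerful_expg (gT : finGroupType) (p : nat) (G : {group gT}) g :
    p.-group G -> odd p -> G^`(1) \subset 'Mho^1(G) -> g \in 'Mho^1(G) ->
  exists2 x, x \in G & g = x ^+ p.
Proof.
move: {2}_.+1 (ltnSn #|G|) => n; elim: n => // n IHn in G g *.
rewrite ltnS => leGn pG p_odd sDM Mg.
have [x Gx Ng] := Mho1_powerful_expg_coset pG p_odd sDM Mg.
have xpM y : y \in G -> y ^+ p \in 'Mho^1(<[y]>).
  move=> Gy; rewrite -[p in y ^+ p]expn1.
  by apply: Mho_p_elt (cycle_id y) (mem_p_elt pG Gy).
pose H := (<[x]> <*> 'Mho^1(G))%G.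
have sHG : H \subset G by rewrite join_subG cycle_subG Gx Mho_sub.
have MHg : g \in 'Mho^1(H).
  rewrite -(mulKVg (x ^+ p) g) groupM //.
    by apply: subsetP (MhoS _ _) _ (xpM x Gx); apply: joing_subl.
  by apply: subsetP (MhoS _ _) _ Ng; apply: joing_subr.
have [eqHG | neqHG] := eqVneq (H : {set gT}) G.
  (* The Frattini subgroup is G^p because G' <= G^p; thus x generates [G] modulo Frattini, and [G]
     is cyclic. *)
  have sXG : 'Phi(G) <*> [set x] = G.
    rewrite (Phi_joing pG) (joing_idPr sDM) joingC -[RHS]eqHG.
    by rewrite /H /= joing_idl.
  have defG : <[x]> = G := Phi_nongen sXG.
  have : g \in 'Mho^1(<[x]>) by rewrite defG.
  rewrite (@MhoEabelian 1 _ p) ?cycle_abelian //; last by rewrite /= defG.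
  by case/imsetP=> y; rewrite /= defG expn1 => Gy ->; exists y.
have{neqHG} ltHG : #|H| < #|G| by rewrite proper_card // properEneq neqHG.
have [||||y Hy ->] := IHn H g _ _ _ _ MHg; last by exists y; rewrite ?(subsetP sHG).
- exact: leq_trans ltHG leGn.
- exact: pgroupS pG.
- by [].
(* Powerfulness of [H]: modulo [G^p, G] it is generated by <x> and a central subgroup, hence
   abelian, so H' <= [G^p, G] <= (G^p)^p <= H^p. *)
apply: subset_trans (_ : 'Mho^1('Mho^1(G)) \subset _); last first.
  by apply: MhoS; apply: joing_subr.
apply: subset_trans (comm_Mho1_sub_Mho2 pG p_odd sDM).
have nLG := commg_normr G 'Mho^1(G).
have nLM := subset_trans (Mho_sub 1 G) nLG.
have nLx : <[x]> \subset 'N([~: 'Mho^1(G), G]) by rewrite cycle_subG (subsetP nLG).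
apply: der1_min; first exact: subset_trans sHG nLG.
rewrite quotientY // abelianY quotient_abelian ?cycle_abelian //=.
rewrite !quotient_cents2r ?andbT //; last by apply: commgS; rewrite cycle_subG.
by rewrite /abelian quotient_cents2r // commgS ?Mho_sub.
Qed.

(** Representatives of a generating set of the quotient generate [G] modulo Frattini, hence generate
    [G]. *)
Lemma grank_le_quotient_Phi (gT : finGroupType) (G : {group gT}) :
  'm(G) <= 'm(G / 'Phi(G)).
Proof.
have [B defG <-] := grank_witness (G / 'Phi(G)).
have sBG : B \subset G / 'Phi(G) by rewrite -defG subset_gen.
have nPG : G \subset 'N('Phi(G)) := normal_norm (Phi_normal G).
pose A := [set repr (b : coset_of 'Phi(G)) | b in B].
have sAG : A \subset G.
  apply/subsetP=> _ /imsetP[b Bb ->].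
  have /morphimP[x Nx Gx def_b] := subsetP sBG b Bb.
  have := mem_repr_coset b; rewrite {2}def_b /= val_coset // => /rcosetP[y Py ->].
  by rewrite groupM // (subsetP (Phi_sub G)).
have defB : A / 'Phi(G) = B.
  apply/setP=> b; apply/morphimP/idP => [[_ _ /imsetP[c Bc ->] ->]|Bb].
    by rewrite /= coset_reprK.
  have Ab : repr b \in A by apply: imset_f.
  by exists (repr b); rewrite /= ?coset_reprK // (subsetP nPG) // (subsetP sAG).
have : 'm(<<A>>) <= #|B| := leq_trans (grank_min _) (leq_imset_card _ _).
suff {1}-> : <<A>> = G by [].
apply: Phi_nongen; apply/eqP; rewrite eqEsubset join_subG Phi_sub sAG /=.
rewrite -(quotientSGK nPG) /= ?joing_subl // -joing_idr.
rewrite quotientYidl ?gen_subG ?(subset_trans sAG) //.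
by rewrite quotient_gen ?(subset_trans sAG) // defB defG.
Qed.

Lemma pgroup_grank_le_logn (gT : finGroupType) (p : nat) (G : {group gT}) :
  p.-group G -> 'm(G) <= logn p #|G / 'Phi(G)|.
Proof.
move=> pG; apply: leq_trans (grank_le_quotient_Phi G) _.
have abE := Phi_quotient_abelem pG.
by rewrite grank_abelian ?(abelem_abelian abE) // (rank_abelem abE).
Qed.

Lemma grank_le2P (gT : finGroupType) (G : {group gT}) :
  'm(G) <= 2 -> exists x y, G :=: <[x]> <*> <[y]>.
Proof.
have [B <- <-] := grank_witness G; case defB: #|B| => [|[|[|//]]] _.
- exists 1, 1; by rewrite (cards0_eq defB) gen0 cycle1 joing1G.
- have /eqP/cards1P[x ->] := defB; by exists x, x; rewrite joingE setUid genGid.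
- have /eqP/cards2P[x [y [_ ->]]] := defB; exists x, y.
  by rewrite joing_idl joing_idr.
Qed.

Lemma power_subgroup_Mho1 (gT : finGroupType) (p : nat) (G : {group gT}) :
  p.-group G -> power_subgroup p G = 'Mho^1(G).
Proof. by move=> pG; rewrite (MhoE 1 pG) expn1. Qed.

(** Modulo L = [G', G] the commutator [x, y] is central, so it generates G'/L. Since L <= [G^p, G]
    <= (G')^p <= Phi(G'), it generates G' itself. *)
Lemma der1_2gen_powerful (gT : finGroupType) (p : nat) (G : {group gT}) (x y : gT) :
    p.-group G -> odd p -> G^`(1) \subset 'Mho^1(G) -> G :=: <[x]> <*> <[y]> ->
  G^`(1) = <[[~ x, y]]>.
Proof.
move=> pG p_odd sDM defG; set D := G^`(1).
pose L := [~: D, G].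
have nLG : L <| G by rewrite /normal commg_normr comm_subG ?der_sub.
have Gx : x \in G by rewrite defG mem_gen // inE cycle_id.
have Gy : y \in G by rewrite defG mem_gen // inE cycle_id orbT.
have nL := normal_norm nLG.
have nLx : <[x]> \subset 'N(L) by rewrite cycle_subG (subsetP nL).
have nLy : <[y]> \subset 'N(L) by rewrite cycle_subG (subsetP nL).
have Nx : x \in 'N(L) by rewrite -cycle_subG.
have Ny : y \in 'N(L) by rewrite -cycle_subG.
have Dc : [~ x, y] \in D by apply: mem_commg.
have Nc : [~ x, y] \in 'N(L) by rewrite (subsetP nL) // (subsetP (der_sub 1 G)).
have sLD : L \subset 'Phi(D).
  have pD := pgroupS (der_sub 1 G) pG.
  apply: subset_trans (commSg _ sDM) _.
  apply: subset_trans (comm_Mho1_powerful pG p_odd sDM) _.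
  by rewrite (Phi_joing pD) joing_subr.
have defGL : G / L = <[coset L x]> <*> <[coset L y]>.
  by rewrite {1}defG quotientY // !quotient_cycle.
have defDL : D / L = <[[~ x, y]]> / L.
  rewrite quotient_der // quotient_cycle // morphR // defGL.
  apply: der1_joing_cycles; rewrite -defGL -morphR //.
  have /subsetP : D / L \subset 'C(G / L) by apply: quotient_cents2r.
  by apply; apply: mem_quotient.
apply/esym; apply: Phi_nongen; apply/eqP.
rewrite eqEsubset join_subG Phi_sub sub1set Dc /=.
have nLD : D \subset 'N(L) := subset_trans (der_sub 1 G) nL.
rewrite -(quotientSGK nLD); last by rewrite (subset_trans sLD) ?joing_subl.
by rewrite /= -/L defDL quotientS //= -joing_idr joing_subr.
Qed.

Lemma powerful_pgroup_der1 (gT : finGroupType) (p : nat) (G : {group gT}) :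
  powerful p G = p.-group G && (G^`(1) \subset 'Mho^1(G)).
Proof.
by rewrite /powerful; case: (boolP (p.-group G)) => //= /power_subgroup_Mho1->.
Qed.

Lemma powerfully_solvable_cons (gT : finGroupType) (p : nat) (G H : {group gT}) :
    p.-group G -> H \subset G -> G^`(1) \subset 'Mho^1(H) ->
  powerfully_solvable p H -> powerfully_solvable p G.
Proof.
move=> pG sHG sDM [pH [s [chain_s last_s]]]; split=> //; exists (H :: s).
by split=> //=; rewrite sHG power_subgroup_Mho1 // sDM.
Qed.

Lemma powerfully_solvable_abelian (gT : finGroupType) (p : nat) (G : {group gT}) :
  p.-group G -> abelian G -> powerfully_solvable p G.
Proof.
move=> pG /derG1P cGG; split=> //; exists [:: 1%G]; split=> //.
by rewrite /powerfully_abelian_chain /= sub1G -derg1 cGG sub1G.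
Qed.

Lemma powerfully_solvable_2gen (gT : finGroupType) (p : nat) (G : {group gT}) :
  odd p -> powerful p G -> 'm(G) <= 2 -> powerfully_solvable p G.
Proof.
move=> p_odd; rewrite powerful_pgroup_der1 => /andP[pG sDM].
case/grank_le2P=> x [y defG]; have defD := der1_2gen_powerful pG p_odd sDM defG.
have Mxy : [~ x, y] \in 'Mho^1(G) by rewrite (subsetP sDM) // defD cycle_id.
have [c Gc def_c] := Mho1_powerful_expg pG p_odd sDM Mxy.
have sCG : <[c]> \subset G by rewrite cycle_subG.
apply: (powerfully_solvable_cons pG sCG); last first.
  exact: powerfully_solvable_abelian (pgroupS sCG pG) (cycle_abelian c).
by rewrite defD def_c (Mho_p_cycle 1 (mem_p_elt pG Gc)) expn1.
Qed.

Lemma powerfully_solvable_2gen_Mho1 (gT : finGroupType) (p : nat) (G : {group gT}) :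
  odd p -> powerful p G -> 'm('Mho^1(G)) <= 2 -> powerfully_solvable p G.
Proof.
move=> p_odd; rewrite powerful_pgroup_der1 => /andP[pG sDM] /grank_le2P[s [t /= defM]].
have Ms : s \in 'Mho^1(G) by rewrite defM mem_gen // inE cycle_id.
have Mt : t \in 'Mho^1(G) by rewrite defM mem_gen // inE cycle_id orbT.
have [x Gx def_s] := Mho1_powerful_expg pG p_odd sDM Ms.
have [y Gy def_t] := Mho1_powerful_expg pG p_odd sDM Mt.
pose H := (<[x]> <*> <[y]>)%G.
have sHG : H \subset G by rewrite join_subG !cycle_subG Gx.
have pH := pgroupS sHG pG.
have sDH : G^`(1) \subset 'Mho^1(H).
  have MH z : z \in H -> z ^+ p \in 'Mho^1(H).
    by move=> Hz; rewrite -[p in z ^+ p]expn1 (Mho_p_elt 1 Hz (mem_p_elt pH Hz)).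
  apply: subset_trans sDM _; rewrite defM join_subG !cycle_subG def_s def_t.
  by rewrite !MH // mem_gen // inE cycle_id ?orbT.
apply: (powerfully_solvable_cons pG sHG sDH).
apply: powerfully_solvable_2gen => //.
  by rewrite powerful_pgroup_der1 pH (subset_trans (dergS 1 sHG)).
rewrite /H /= joing_idl joing_idr; apply: leq_trans (grank_min _) _.
by rewrite cards2; case: (x == y).
Qed.

Theorem mainTheorem4 (gT : finGroupType) (p : nat) (G : {group gT})
  (p_pr : prime p) (p_odd : odd p)
  (G_powerful : powerful p G) (G_order : (#|G| <= p ^ 5)%N) :
  powerfully_solvable p G.
Proof.
have := G_powerful; rewrite powerful_pgroup_der1 => /andP[pG sDM].
have [mG_le2 | mG_gt2] := leqP 'm(G) 2; first exact: powerfully_solvable_2gen.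
apply: powerfully_solvable_2gen_Mho1 => //.
have pM := pgroupS (Mho_sub 1 G) pG.
have := leq_trans mG_gt2 (pgroup_grank_le_logn pG).
apply: contraTT; rewrite -!ltnNge => mM_gt2.
have logM : 2 < logn p #|'Mho^1(G)|.
  apply: leq_trans mM_gt2 (leq_trans (pgroup_grank_le_logn pM) _).
  by rewrite dvdn_leq_log ?dvdn_quotient.
have logG : logn p #|G| <= 5.
  by rewrite -(@leq_exp2l p) ?prime_gt1 // -card_pgroup.
(* With Phi(G) = G^p of order at least p^3 and |G| <= p^5, the Frattini quotient has order at most
   p^2. *)
rewrite (Phi_joing pG) (joing_idPr sDM) card_quotient ?normal_norm ?Mho_normal //.
rewrite -divgS ?Mho_sub // logn_div ?cardSg ?Mho_sub //.
by rewrite ltnS leq_subLR (leq_trans logG) // (leq_add2r 2 3).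
Qed.
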